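(* If $k=\ell$, then, for all $n$, the identity permutation $(1,2,\ldots,n)\in S_n$ does not have an $\ell$-additive subsequence of length $k$.
   Context: Here $k$, $\ell$ and $n$ denote positive integers. $S_n$ denotes the set of permutations of $\{1,2,\ldots,n\}$ written in one-line notation $p=(p_1,p_2,\ldots,p_n)$. A subsequence of $p$ of length $k$ is a sequence $(p_{i_1},\ldots,p_{i_k})$ with $i_1<\cdots<i_k$. A sequence $(a_1,a_2,\ldots,a_k)$ of positive integers is called $\ell$-additive if $a_1+a_2+\cdots+a_k=\ell a_1$ or $a_1+a_2+\cdots+a_k=\ell a_k$.
   Formalization: The formal theorem assumes k ≥ 2; for k = ℓ = 1 the claim is false, since every one-term subsequence (a_1) of the identity satisfies a_1 = 1·a_1 and so is 1-additive. *)

(* Defs.v *)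
From mathcomp Require Import all_boot all_fingroup.

Set Implicit Arguments.
Unset Strict Implicit.
Unset Printing Implicit Defensive.

(* 'S_n permutes {0, ..., n-1}; the shift by one gives the values 1, ..., n. *)
Definition one_line (n : nat) (p : 'S_n) : seq nat :=
  [seq (val (p i)).+1 | i <- enum 'I_n].

(* Meant for nonempty sequences of positive integers; on those the default 0
   of [head] and [last] is never used.  Every one-term sequence is 1-additive,
   so statements about the case k = l need 1 < k. *)
Definition additive (l : nat) (a : seq nat) : Prop :=
  sumn a = l * head 0 a \/ sumn a = l * last 0 a.

Definition has_additive_subseq (l k n : nat) (p : 'S_n) : Prop :=
  exists a : seq nat, [/\ subseq a (one_line p), size a = k & additive l a].

Lemma one_line1 (n : nat) : one_line (1%g : 'S_n) = iota 1 n.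
Proof.
rewrite /one_line (eq_map (g := S \o val)); last by move=> i /=; rewrite perm1.
by rewrite map_comp val_enum_ord -[1]addn0 iotaDl.
Qed.

(* Main.v *)
Require Import Defs.
From mathcomp Require Import all_boot all_fingroup.

(** The sum of a sequence with [k] terms equals [k] times one of its terms only
    if that term is the average.  A subsequence of the identity permutation is
    strictly increasing, so with at least two terms its first term is strictly
    below the average and its last one strictly above: [ltn_size_head_sumn] and
    [ltn_sumn_size_last].  Hence neither form of [k]-additivity can hold. *)

Lemma leq_size_sumn (m : nat) (s : seq nat) :
  all (leq m) s -> size s * m <= sumn s.
Proof. by elim: s => //= x s IHs /andP[mx /IHs ms]; rewrite mulSn leq_add. Qed.

(** Each term is at most [m - 1]; putting [size s] on the left keeps the bound
    free of truncated subtraction. *)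
Lemma leq_sumn_size (m : nat) (s : seq nat) :
  all (gtn m) s -> sumn s + size s <= size s * m.
Proof.
elim: s => //= x s IHs /andP[xm /IHs sm].
by rewrite mulSn addnS -!addSn -addnA leq_add.
Qed.

Lemma ltn_size_head_sumn (a : seq nat) :
  sorted ltn a -> 1 < size a -> size a * head 0 a < sumn a.
Proof.
rewrite (sorted_pairwise ltn_trans); case: a => // x s /= /andP[xs _] s_gt0.
rewrite mulSn ltn_add2l; apply: leq_trans (leq_size_sumn x.+1 s xs).
by rewrite ltn_pmul2l.
Qed.

Lemma ltn_sumn_size_last (a : seq nat) :
  sorted ltn a -> 1 < size a -> sumn a < size a * last 0 a.
Proof.
rewrite (sorted_pairwise ltn_trans); case/lastP: a => // s y.
rewrite pairwise_rcons size_rcons last_rcons sumn_rcons => /andP[sy _] s_gt0.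
rewrite mulSn addnC ltn_add2l; apply: leq_trans (leq_sumn_size y s sy).
by rewrite -[X in X < _]addn0 ltn_add2l.
Qed.

Theorem proposition4p1 (k l : nat) (hk : 1 < k) (hl : 0 < l) (hkl : k = l) :
  forall n : nat, 0 < n -> ~ has_additive_subseq l k (1%g : 'S_n).
Proof.
move=> n _ [a [sub_a size_a add_a]]; subst l k.
have a_sorted : sorted ltn a.
  apply: (subseq_sorted ltn_trans sub_a).
  by rewrite one_line1 iota_ltn_sorted.
have := ltn_size_head_sumn a a_sorted hk.
have := ltn_sumn_size_last a a_sorted hk.
by case: add_a => ->; rewrite ltnn.
Qed.
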